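(* Let $m,n,r,k$ be positive integers with $k\le\min\{m,n\}$. Let $\mathcal{A}\in\mathbb{R}^{m\times n\times r}$ and let $\mathcal{U}\in\mathbb{R}^{m\times k\times r}$ and $\mathcal{V}\in\mathbb{R}^{n\times k\times r}$ be two partially orthogonal tensors. Then $$\sigma_i(\mathcal{U}^{\mathrm T}*\mathcal{A}*\mathcal{V})\le\sigma_i(\mathcal{A}),\qquad i=1,\dots,k,$$ where $\sigma_i(\cdot)$ denotes the $i$-th largest (tensor) singular value.
   Context: For a third-order tensor $\mathcal{A}\in\mathbb{R}^{m\times n\times r}$, let $A_l=\mathcal{A}(:,:,l)\in\mathbb{R}^{m\times n}$, $l=1,\dots,r$, be its frontal slices. T-product: for $\mathcal{A}\in\mathbb{R}^{m\times n\times r}$ and $\mathcal{B}\in\mathbb{R}^{n\times t\times r}$, $\mathcal{A}*\mathcal{B}\in\mathbb{R}^{m\times t\times r}$ is the tensor whose frontal slices, stacked vertically, form the product of the block-circulant matrix with first block column $(A_1;A_2;\dots;A_r)$ and the stacked matrix $(B_1;B_2;\dots;B_r)$; that is, $(\mathcal{A}*\mathcal{B})_l=\sum_{j=1}^{r}A_{((l-j)\bmod r)+1}B_j$. Transpose: for $\mathcal{A}\in\mathbb{R}^{m\times n\times r}$, $\mathcal{A}^{\mathrm T}\in\mathbb{R}^{n\times m\times r}$ is obtained by transposing each frontal slice and then reversing the order of the transposed slices $2$ through $r$, i.e. $(\mathcal{A}^{\mathrm T})_1=A_1^{\mathrm T}$ and $(\mathcal{A}^{\mathrm T})_l=A_{r+2-l}^{\mathrm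 T}$ for $2\le l\le r$. Identity tensor: $\mathcal{I}_{kkr}\in\mathbb{R}^{k\times k\times r}$ has first frontal slice equal to the $k\times k$ identity matrix and all other frontal slices zero. A tensor $\mathcal{Q}\in\mathbb{R}^{p\times q\times r}$ is partially orthogonal if $\mathcal{Q}^{\mathrm T}*\mathcal{Q}=\mathcal{I}_{qqr}$. Discrete Fourier transform along the third mode: $\hat A_l=\sum_{j=1}^{r}\omega^{(l-1)(j-1)}A_j$ with $\omega=e^{-2\pi \mathtt{i}/r}$, $l=1,\dots,r$. Tensor singular values: $\mathcal{A}$ has a T-SVD $\mathcal{A}=\mathcal{U}_0*\mathcal{S}*\mathcal{V}_0^{\mathrm T}$ (with $\mathcal{U}_0\in\mathbb{R}^{m\times m\times r},\mathcal{V}_0\in\mathbb{R}^{n\times n\times r}$ orthogonal tensors, i.e. $\mathcal{Q}^{\mathrm T}*\mathcal{Q}=\mathcal{Q}*\mathcal{Q}^{\mathrm T}=\mathcal{I}$, and $\mathcal{S}$ having diagonal frontal slices) in which the diagonal of the $l$-th Fourier-transformed frontal slice $\hat{S}_l$ of $\mathcal{S}$ consists of the singular values of the matrix $\hat A_l$ in decreasing order. The singular values of $\mathcal{A}$ are the diagonal entries of the first frontal slice $\mathcal{S}(:,:,1)$. Equivalently, if $\sigma_1(\hat A_l)\ge\cdots\ge\sigma_{\min\{m,n\}}(\hat A_l)\ge 0$ are the ordinary singular values of $\hat A_l$, the $i$-th singular value of $\mathcal{A}$ is $$\sigma_i(\mathcal{A})=\frac1r\sum_{l=1}^{r}\sigma_i(\hat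 A_l),\qquad i=1,\dots,\min\{m,n\}.$$ *)

(* Defs.v *)
From mathcomp Require Import all_boot all_order all_algebra.
From mathcomp Require Import sesquilinear spectral.
From mathcomp Require Import reals trigo.
From mathcomp Require Import complex.

Set Implicit Arguments.
Unset Strict Implicit.
Unset Printing Implicit Defensive.

Import Order.TTheory GRing.Theory Num.Theory.
Local Open Scope ring_scope.
Local Open Scope complex_scope.
Local Open Scope sesquilinear_scope.

(* An m x n x (r+1) tensor is the family of its frontal slices.  Slices are
   indexed from 0, by 'I_r.+1 with its additive group structure of integers
   modulo r+1, so that differences and opposites of slice indices are cyclic. *)
Definition tensor (K : Type) (m n r : nat) := {ffun 'I_r.+1 -> 'M[K]_(m, n)}.

Section TProduct.
Variables (K : pzRingType) (r : nat).

Definition tprod m n t (A : tensor K m n r) (B : tensor K n t r) :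
    tensor K m t r :=
  [ffun l : 'I_r.+1 => \sum_(j < r.+1) A (l - j) *m B j].

(* In 0-based indexing, slice l of the transpose comes from slice
   (r+1) - l if l > 0, and from slice 0 if l = 0: this is - l. *)
Definition ttr m n (A : tensor K m n r) : tensor K n m r :=
  [ffun l : 'I_r.+1 => (A (- l))^T].

Definition tid k : tensor K k k r :=
  [ffun l : 'I_r.+1 => if l == 0 then 1%:M else 0].

Definition partially_orthogonal p q (Q : tensor K p q r) : Prop :=
  tprod (ttr Q) Q = tid q.

Definition orthogonal_tensor p (Q : tensor K p p r) : Prop :=
  tprod (ttr Q) Q = tid p /\ tprod Q (ttr Q) = tid p.

End TProduct.

Section SingularValues.
Variable R : realType.

(* exp (- 2 pi i / (r+1)) *)
Definition omega (r : nat) : R[i] :=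
  let theta := 2 * pi / r.+1%:R in cos theta -i* sin theta.

Definition dft m n r (A : tensor R m n r) : tensor R[i] m n r :=
  [ffun l : 'I_r.+1 =>
    \sum_(j < r.+1) omega r ^+ (l * j) *: map_mx (real_complex R) (A j)].

(* Square roots of the eigenvalues (with multiplicity) of the Hermitian
   matrix M^* M, in decreasing order.  There are n of them: the first
   min(m, n) are the usual singular values, the others are 0. *)
Definition sing_vals m n (M : 'M[R[i]]_(m, n)) : seq R :=
  sort >=%R [seq Num.sqrt (complex.Re (spectral_diag (M^t* *m M) 0 j))
            | j <- enum 'I_n].

(* The i-th largest singular value, counted from i = 0. *)
Definition sing_val m n (M : 'M[R[i]]_(m, n)) (i : nat) : R :=
  nth 0 (sing_vals M) i.

Definition tsing_val m n r (A : tensor R m n r) (i : nat) : R :=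
  r.+1%:R^-1 * \sum_(l < r.+1) sing_val (dft A l) i.

Definition is_TSVD m n r (A : tensor R m n r) (U : tensor R m m r)
    (S : tensor R m n r) (V : tensor R n n r) : Prop :=
  [/\ orthogonal_tensor U, orthogonal_tensor V,
      A = tprod (tprod U S) (ttr V),
      forall (l : 'I_r.+1) (i : 'I_m) (j : 'I_n), (i : nat) != j -> S l i j = 0
    & forall (l : 'I_r.+1) (i : 'I_m) (j : 'I_n), (i : nat) = j ->
        dft S l i j = (sing_val (dft A l) i)%:C].

Lemma omegaX r k : omega r ^+ k =
  cos (2 * pi / r.+1%:R *+ k) -i* sin (2 * pi / r.+1%:R *+ k).
Proof.
elim: k => [|k IHk]; first by rewrite expr0 mulr0n cos0 sin0 oppr0.
rewrite exprSr IHk [_ *+ k.+1]mulrSr cosD sinD.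
by apply/eqP; rewrite eq_complex/= mulrNN mulrN mulNr opprD addrC eqxx addrC eqxx.
Qed.

Lemma sum_omegaX r (j : 'I_r.+1) :
  \sum_(l < r.+1) omega r ^+ (l * j) = if j == 0 then r.+1%:R else 0.
Proof.
case: eqP => [->|/eqP j0].
  rewrite (eq_bigr (fun=> 1)) => [|l _]; last by rewrite muln0 expr0.
  by rewrite sumr_const card_ord.
have jn0 : (0 < j)%N by rewrite lt0n; apply: contra j0 => /eqP ?; apply/eqP/val_inj.
have r0 : (0 : R) < r.+1%:R by rewrite ltr0n.
have wn1 : omega r ^+ j != 1.
  rewrite omegaX; apply/eqP => -[+ _].
  set t := _ *+ j.
  have tE : t = (t / 2) *+ 2 by rewrite -mulr_natr divfK// pnatr_eq0.
  have : 0 < sin (t / 2).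
    apply: sin_gt0_pi; apply/andP; split.
      by rewrite divr_gt0// /t pmulrn_rgt0// divr_gt0// mulr_gt0// pi_gt0.
    rewrite ltr_pdivrMr// /t -[_ *+ j]mulr_natr mulrAC ltr_pdivrMr//.
    by rewrite [pi * 2]mulrC ltr_pM2l ?ltr_nat// mulr_gt0// pi_gt0.
  move=> s0 /eqP; rewrite tE; move: (t / 2) s0 => s s0.
  rewrite mulr2n cosD -!expr2 cos2sin2 -addrA -opprD addrC -subr_eq0 addrK.
  by rewrite oppr_eq0 paddr_eq0 ?sqr_ge0// andbb expf_eq0/= (gt_eqF s0).
have w1 : omega r ^+ r.+1 = 1.
  rewrite omegaX -mulr_natr divfK ?(gt_eqF r0)//.
  by rewrite mulr_natl mulr2n -[pi + pi]add0r addrA !(cosDpi, sinDpi) cos0 sin0 !opprK oppr0.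
apply/eqP; rewrite -(mulrI_eq0 _ (@lregP _ (omega r ^+ j - 1) _)) ?subr_eq0//.
rewrite (eq_bigr (fun l : 'I_r.+1 => (omega r ^+ j) ^+ l)) => [|l _].
  by rewrite -subrX1 -exprM mulnC exprM w1 expr1n subrr.
by rewrite mulnC exprM.
Qed.

(* The singular values of A are the diagonal entries of the first frontal
   slice of S, for every T-SVD of A. *)
Lemma TSVD_tsing_val m n r (A : tensor R m n r) U S V :
  is_TSVD A U S V ->
  forall (i : 'I_m) (j : 'I_n), (i : nat) = j -> S 0 i j = tsing_val A i.
Proof.
case=> _ _ _ _ dS i j ij; apply: (@complexI R).
rewrite /tsing_val rmorphM fmorphV rmorph_nat rmorph_sum/=.
rewrite -(eq_bigr _ (fun l _ => dS l i j ij)).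
rewrite (eq_bigr (fun l : 'I_r.+1 =>
  \sum_(k < r.+1) omega r ^+ (l * k) * (S k i j)%:C)); last first.
  by move=> l _; rewrite ffunE summxE; apply: eq_bigr => k _; rewrite !mxE.
rewrite exchange_big/= (bigD1 0)//= [X in _ + X]big1 ?addr0 => [|k k0].
  by rewrite -mulr_suml (sum_omegaX 0) eqxx mulKf// pnatr_eq0.
by rewrite -mulr_suml sum_omegaX (negbTE k0) mul0r.
Qed.

End SingularValues.

(* Main.v *)
Require Import Defs.
From mathcomp Require Import all_boot all_order all_algebra.
From mathcomp Require Import reals.
From mathcomp Require Import sesquilinear spectral trigo complex.
From mathcomp Require Import ring.

(** The discrete Fourier transform along the third mode block-diagonalizes the
block circulant matrix: it turns the T-product into the product of matrices slice
by slice ([dft_tprod]) and, since the slices are real, the transpose into the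
conjugate transpose ([dft_ttr]).  Partial orthogonality of a tensor thus says
that its transformed slices have orthonormal columns, and as a tensor singular
value is the average of those of the transformed slices, it is enough to
compare them slice by slice: [sing_val_compression] shows that compressing a
matrix M to P M W^*, where P and W have orthonormal rows, does not increase
its singular values.

This is a Courant-Fischer argument in counting form.  The values of the
quadratic form of (P M W^* )^* (P M W^* ) at x are at most those of the form of
M^* M at x W, because P is a contraction, and x -> x W is isometric.  Then, for
every real c, the first matrix has at most as many eigenvalues above c as the
second ([card_spectral_gt]): otherwise, the dimensions would force some nonzero
x, spanned by the eigenvectors of the first matrix with eigenvalue above c, to
have an image x W orthogonal to all those of the second one, and comparing the
two forms at x gives a contradiction.  Working with the number of values above
a threshold means that sorted lists occur only in [lt_nth_sorted]. *)

Set Implicit Arguments.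
Unset Strict Implicit.
Unset Printing Implicit Defensive.

Local Open Scope ring_scope.

Import Order.TTheory GRing.Theory Num.Theory.
Local Open Scope complex_scope.
Local Open Scope sesquilinear_scope.

(** * Order statistics by counting *)

(** In a decreasing list the entries above [c] form an initial segment. *)
Lemma lt_nth_sorted (R : realDomainType) (c : R) (s : seq R) (i : nat) :
  sorted >=%R s -> (i < size s)%N ->
  (c < nth 0 s i) = (i < count (> c) s)%N.
Proof.
elim: s i => [//|x s IH] i /= xs.
have sorted_s : sorted >=%R s by exact: path_sorted xs.
have le_x : all (>=%R x) s.
  by apply: order_path_min xs => a b d ba db; exact: le_trans db ba.
case: (ltP c x) => cx; first by case: i => [|i] //=; rewrite ltnS => /IH ->.
have s0 : count (> c) s = 0%N.
  apply/eqP; rewrite -leqn0 leqNgt -has_count -all_predC.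
  apply: sub_all le_x => y /= yx; rewrite -leNgt; exact: le_trans yx cx.
case: i => [|i] /= i_lt; rewrite s0; first by rewrite ltNge cx.
by rewrite IH // s0.
Qed.

(** * Hermitian forms and eigenvalue counts *)

Section HermitianForms.
Variable C : numClosedFieldType.

Definition form n (H : 'M[C]_n) (x : 'rV[C]_n) : C := (x *m H *m x^t*) 0 0.

Definition sqnorm n (x : 'rV[C]_n) : C := (x *m x^t*) 0 0.

Lemma sqnormE n (x : 'rV[C]_n) : sqnorm x = \sum_j `|x 0 j| ^+ 2.
Proof.
by rewrite /sqnorm mxE; apply: eq_bigr => j _; rewrite !mxE normCK.
Qed.

Lemma sqnorm_ge0 n (x : 'rV[C]_n) : 0 <= sqnorm x.
Proof. by rewrite sqnormE sumr_ge0 // => j _; rewrite exprn_ge0. Qed.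

Lemma adjM m n p (A : 'M[C]_(m, n)) (B : 'M[C]_(n, p)) :
  (A *m B)^t* = B^t* *m A^t*.
Proof. by rewrite trmx_mul map_mxM. Qed.

Lemma sqnorm_unitary m n (P : 'M[C]_(m, n)) x :
  P \is unitarymx -> sqnorm (x *m P) = sqnorm x.
Proof. by move=> uP; rewrite /sqnorm adjM mulmxA mulmxtVK. Qed.

(** Pythagoras: [x *m P^t* *m P] is the orthogonal projection of [x] on the row
space of [P], and the squared norm of the rest is the difference of the two
sides. *)
Lemma sqnorm_proj_le m n (P : 'M[C]_(m, n)) (x : 'rV[C]_n) :
  P \is unitarymx -> sqnorm (x *m P^t*) <= sqnorm x.
Proof.
move=> uP; rewrite -subr_ge0.
have <- : sqnorm (x - x *m P^t* *m P) = sqnorm x - sqnorm (x *m P^t*).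
  rewrite /sqnorm.
  have -> : (x - x *m P^t* *m P)^t* = x^t* - P^t* *m P *m x^t*.
    by rewrite raddfB /= map_mxB !adjM trmxCK mulmxA.
  rewrite adjM trmxCK mulmxBr !mulmxBl !mulmxA.
  rewrite (mulmxtVK (x *m P^t*)) //.
  by rewrite !mxE; ring.
exact: sqnorm_ge0.
Qed.

(** In coordinates along an orthonormal eigenbasis, the form is diagonal. *)
Lemma formE n (H : 'M[C]_n) x : H \is hermsymmx ->
  form H x = \sum_j spectral_diag H 0 j
                     * `|(x *m (spectralmx H)^t*) 0 j| ^+ 2.
Proof.
move=> /hermitian_normalmx/orthomx_spectralP HE.
rewrite /form {1}HE invmx_unitary ?spectral_unitarymx //.
rewrite !mulmxA -[_ *m x^t*]mulmxA -[X in _ *m (X *m _)]trmxCK -adjM.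
set y := x *m _; rewrite mul_mx_diag mxE; apply: eq_bigr => j _.
by rewrite !mxE normCK mulrAC mulrC.
Qed.

(** If [G] had more eigenvalues above [c] than [H], then the combinations of
the corresponding eigenvectors of [G] would outnumber the linear equations
saying that the image under [W] has no component along the eigenvectors of [H]
with eigenvalue above [c].  A nonzero solution [x] would satisfy
[c * sqnorm x < form G x <= form H (x *m W) <= c * sqnorm (x *m W)], although
[W] is isometric. *)
Lemma card_spectral_gt k n (G : 'M[C]_k) (H : 'M[C]_n) (W : 'M[C]_(k, n)) c :
  G \is hermsymmx -> H \is hermsymmx -> W \is unitarymx ->
  (forall x, form G x <= form H (x *m W)) -> c \is Num.real ->
  (#|[pred j | (c < spectral_diag G 0 j)%R]| <=
   #|[pred j | (c < spectral_diag H 0 j)%R]|)%N.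
Proof.
move=> hG hH uW GH c_real.
set J := [pred j | _]; set K := [pred j | _]; rewrite leqNgt; apply/negP => KJ.
pose f (a : 'I_#|J|) : 'I_k := enum_val a.
pose g (b : 'I_#|K|) : 'I_n := enum_val b.
pose P := spectralmx G; pose Q := spectralmx H.
have uP : P \is unitarymx by exact: spectral_unitarymx.
have uQ : Q \is unitarymx by exact: spectral_unitarymx.
(* [y *m Z] lists the components along the eigenvectors of [H] indexed by [K] of
   the image under [W] of the combination, with coefficients [y], of the
   eigenvectors of [G] indexed by [J]. *)
pose Z := colsub g (rowsub f P *m W *m Q^t*).
have /rowV0Pn[y /sub_kermxP yZ y_neq0] : kermx Z != 0.
  by rewrite -mxrank_eq0 mxrank_ker -lt0n subn_gt0 (leq_ltn_trans (rank_leq_col _)).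
pose x := y *m rowsub f P.
(* The coordinates of [x] and of its image in the two eigenbases. *)
pose a := x *m P^t*; pose b := x *m W *m Q^t*.
have aE : a = y *m rowsub f 1%:M.
  by rewrite /a /x -mulmxA mul_rowsub_mx (unitarymxP uP).
have a_out j : j \notin J -> a 0 j = 0.
  move=> jJ; rewrite aE mxE big1 // => u _; rewrite !mxE.
  case: eqP => [fj|_]; last by rewrite mulr0.
  by move: jJ; rewrite -fj enum_valP.
have a_in u : a 0 (f u) = y 0 u.
  rewrite aE mxE (bigD1 u) //= big1 ?addr0 => [|v vu].
    by rewrite !mxE eqxx mulr1.
  by rewrite !mxE (inj_eq enum_val_inj) (negbTE vu) mulr0.
have b_in l : l \in K -> b 0 l = 0.
  move=> lK; have gb : colsub g b = 0.
    by rewrite -yZ /b /x /Z mulmx_colsub !mulmxA.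
  have := congr1 (fun z : 'rV_ _ => z 0 (enum_rank_in lK l)) gb.
  by rewrite !mxE /g enum_rankK_in.
have ab : \sum_j `|a 0 j| ^+ 2 = \sum_l `|b 0 l| ^+ 2.
  rewrite -!sqnormE (sqnorm_unitary x) ?trmxC_unitary //.
  by rewrite (sqnorm_unitary (x *m W)) ?trmxC_unitary // (sqnorm_unitary x).
have : c * \sum_j `|a 0 j| ^+ 2 < form G x.
  rewrite formE // -/P -/a mulr_sumr -subr_gt0 -sumrB.
  have ge0 j : 0 <= spectral_diag G 0 j * `|a 0 j| ^+ 2 - c * `|a 0 j| ^+ 2.
    rewrite -mulrBl; have [jJ|/a_out ->] := boolP (j \in J).
      by rewrite mulr_ge0 ?exprn_ge0 // subr_ge0 ltW.
    by rewrite normr0 expr0n mulr0.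
  have /rV0Pn[u yu] := y_neq0.
  rewrite (bigD1 (f u)) //= ltr_pwDl ?sumr_ge0 //.
  rewrite -mulrBl mulr_gt0 ?exprn_gt0 ?normr_gt0 ?a_in // subr_gt0.
  by have := enum_valP u.
apply/negP; rewrite le_gtF // (le_trans (GH x)) // formE // -/Q -/b ab.
rewrite mulr_sumr ler_sum // => l _; have [/b_in ->|lK] := boolP (l \in K).
  by rewrite normr0 expr0n !mulr0.
rewrite ler_wpM2r ?exprn_ge0 // real_leNgt //.
have /mxOverP := hermitian_spectral_diag_real hH; exact.
Qed.

End HermitianForms.

(** * Singular values of a compression *)

Section MatrixSingularValues.
Variable R : realType.
Local Notation C := R[i].

Lemma hermsym_gram m n (M : 'M[C]_(m, n)) : M^t* *m M \is hermsymmx.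
Proof. by apply/is_hermitianmxP; rewrite scale1r adjM trmxCK. Qed.

Lemma form_gram m n (M : 'M[C]_(m, n)) x :
  form (M^t* *m M) x = sqnorm (x *m M^t*).
Proof. by rewrite /form /sqnorm adjM trmxCK !mulmxA. Qed.

Lemma size_sing_vals m n (M : 'M[C]_(m, n)) : size (sing_vals M) = n.
Proof. by rewrite size_sort size_map size_enum_ord. Qed.

(** The singular values above [c >= 0] are the square roots of the eigenvalues of
the Gram matrix above [c ^+ 2], whose number [card_spectral_gt] controls. *)
Lemma lt_sing_val m n (M : 'M[C]_(m, n)) (c : R) i : 0 <= c -> (i < n)%N ->
  (c < sing_val M i) =
  (i < #|[pred j | ((c ^+ 2)%:C < spectral_diag (M^t* *m M) 0 j)%R]|)%N.
Proof.
move=> c_ge0 i_lt; rewrite lt_nth_sorted ?size_sing_vals //; last first.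
  by apply: sort_sorted => x y; exact: le_total.
rewrite count_sort count_map -size_filter cardE.
rewrite /enum_mem -filter_predI; congr (_ < size _)%N.
apply: eq_filter => j /=; rewrite andbT inE.
set d := spectral_diag _ 0 j.
have d_real : d \is Num.real.
  by have /mxOverP := hermitian_spectral_diag_real (hermsym_gram M); exact.
rewrite -[d in RHS]RRe_real // ltcR; set t := complex.Re d.
have [t_gt0|t_le0] := ltP 0 t.
  by rewrite -{1}(ger0_norm c_ge0) -sqrtr_sqr ltr_sqrt.
by rewrite ler0_sqrtr // !le_gtF // (le_trans t_le0) // sqr_ge0.
Qed.

Lemma sing_val_ge0 m n (M : 'M[C]_(m, n)) i : 0 <= sing_val M i.
Proof.
rewrite /sing_val; have [i_lt|i_ge] := ltnP i (size (sing_vals M)); last first.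
  by rewrite nth_default.
have /allP : all (>= 0) (sing_vals M).
  by rewrite all_sort; apply/allP => _ /mapP[j _ ->]; exact: sqrtr_ge0.
by apply; exact: mem_nth.
Qed.

(** With the threshold [c := sing_val M i], at most [i] eigenvalues of the Gram
matrix of [M] exceed [c ^+ 2], hence at most [i] of that of the compression. *)
Lemma sing_val_compression m n p k (M : 'M[C]_(m, n))
    (P : 'M[C]_(p, m)) (W : 'M[C]_(k, n)) i :
  P \is unitarymx -> W \is unitarymx -> (i < k)%N ->
  sing_val (P *m M *m W^t*) i <= sing_val M i.
Proof.
move=> uP uW i_lt; rewrite leNgt; apply/negP.
have kn : (k <= n)%N by rewrite -(mxrank_unitary uW) rank_leq_col.
have i_ltn : (i < n)%N by exact: leq_trans kn.
rewrite lt_sing_val ?sing_val_ge0 //.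
set c := sing_val M i.
have : (i < #|[pred j | ((c ^+ 2)%:C < spectral_diag (M^t* *m M) 0 j)%R]|)%N = false.
  by rewrite -lt_sing_val ?sing_val_ge0 // ltxx.
apply/contraFnot => /leq_trans; apply.
apply: (card_spectral_gt (W := W)) => //; first exact: hermsym_gram.
- exact: hermsym_gram.
- move=> x; rewrite !form_gram !adjM trmxCK !mulmxA.
  exact: sqnorm_proj_le.
- by rewrite complex_real.
Qed.

End MatrixSingularValues.

(** * The Fourier transform of a tensor *)

Section Fourier.
Variables (R : realType) (r : nat).
Local Notation C := R[i].
Local Notation w := (omega R r).

Lemma omega_expS : w ^+ r.+1 = 1.
Proof.
rewrite omegaX -[_ *+ r.+1]mulr_natr divfK ?pnatr_eq0 //.
by rewrite mulr_natl cos2pi sin2pi oppr0.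
Qed.

Lemma conj_omega_exp k : (w ^+ k)^* = (w ^+ k)^-1.
Proof.
have w1 : `|w| = 1.
  by apply/eqP; rewrite -(@pexpr_eq1 _ _ r.+1) // -normrX omega_expS normr1.
by rewrite invC_norm normrX w1 !expr1n invr1 mul1r.
Qed.

(** The sum [i + j] is taken modulo [r.+1], which [omega_expS] makes harmless:
the exponential is a character of the cyclic group of slice indices. *)
Lemma omega_expD l (i j : 'I_r.+1) :
  w ^+ (l * (i + j)%R) = w ^+ (l * i) * w ^+ (l * j).
Proof.
by rewrite -exprD -mulnDr /= !(mulnC l) !exprM (expr_mod _ omega_expS).
Qed.

Lemma omega_expN l (j : 'I_r.+1) : w ^+ (l * (- j)%R) = (w ^+ (l * j))^*.
Proof.
rewrite conj_omega_exp; apply/esym/mulr1_eq.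
by rewrite -omega_expD subrr muln0 expr0.
Qed.

(** The convolution theorem. *)
Lemma dft_tprod m n t (A : tensor R m n r) (B : tensor R n t r) l :
  dft (tprod A B) l = dft A l *m dft B l.
Proof.
rewrite !ffunE mulmx_sumr.
under eq_bigr => p _ do rewrite ffunE map_mx_sum scaler_sumr.
rewrite exchange_big; apply: eq_bigr => j _ /=.
rewrite (reindex_inj (addIr j)) mulmx_suml; apply: eq_bigr => p _ /=.
by rewrite addrK map_mxM omega_expD -scalemxAl -scalemxAr scalerA.
Qed.

(** Reversing the slices conjugates the exponentials, and the slices themselves
are unchanged by conjugation since they are real. *)
Lemma dft_ttr m n (A : tensor R m n r) l : dft (ttr A) l = (dft A l)^t*.
Proof.
rewrite !ffunE (reindex_inj oppr_inj) raddf_sum map_mx_sum.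
apply: eq_bigr => j _ /=; apply/matrixP => a b.
rewrite ffunE opprK omega_expN !mxE rmorphM; congr (_ * _).
by apply/esym/conj_Creal; rewrite complex_real.
Qed.

Lemma dft_tid k l : dft (tid R r k) l = 1%:M.
Proof.
rewrite ffunE (bigD1 0) //= big1 => [|j j0]; last first.
  by rewrite ffunE (negbTE j0) map_mx0 scaler0.
by rewrite ffunE eqxx map_mx1 muln0 expr0 scale1r addr0.
Qed.

Lemma dft_partially_orthogonal p q (Q : tensor R p q r) l :
  partially_orthogonal Q -> (dft Q l)^t* \is unitarymx.
Proof.
by move=> QQ; apply/unitarymxP; rewrite trmxCK -dft_ttr -dft_tprod QQ dft_tid.
Qed.

End Fourier.

Theorem theorem5p2 (R : realType) (m n r k : nat)
    (m_gt0 : (0 < m)%N) (n_gt0 : (0 < n)%N) (k_gt0 : (0 < k)%N)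
    (k_le : (k <= minn m n)%N)
    (A : tensor R m n r) (U : tensor R m k r) (V : tensor R n k r)
    (U_po : partially_orthogonal U) (V_po : partially_orthogonal V)
    (i : nat) (i_lt : (i < k)%N) :
  tsing_val (tprod (tprod (ttr U) A) V) i <= tsing_val A i.
Proof.
rewrite ler_wpM2l ?invr_ge0 ?ler0n // ler_sum // => l _.
rewrite !dft_tprod dft_ttr -[dft V l]trmxCK.
by apply: sing_val_compression => //; exact: dft_partially_orthogonal.
Qed.
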